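(* Let $(X,X_+,\mathcal K,f)$ be a strong abstract state space and let $\mathcal T=(T_t)_{t\ge0}$ be a $C_0$-Markov semigroup on $X$. Then the following statements are equivalent: (i) $\mathcal T$ is weakly mean ergodic, i.e. $\lim_{t\to\infty}\sup_{x,y\in\mathcal K}\|A_t(\mathcal T)x-A_t(\mathcal T)y\|=0$; (ii) there exists $t_0>0$ such that $\delta(A_{t_0}(\mathcal T))<1$; (iii) $\mathcal T$ is uniformly mean ergodic, i.e. there exists $x_0\in\mathcal K$ such that $\lim_{t\to\infty}\|A_t(\mathcal T)-T_{x_0}\|=0$.
   Context: Abstract state space $(X,X_+,\mathcal K,f)$: $X$ is a real vector space ordered by a generating cone $X_+$ (so $X=X_+-X_+$), $f$ is a linear functional on $X$ with $f(x)>0$ for all $x\in X_+\setminus\{0\}$, and $\mathcal K=\{x\in X_+: f(x)=1\}$. Let $U$ be the convex hull of $\mathcal K\cup(-\mathcal K)$ and $\|x\|=\inf\{\lambda\ge0: x\in\lambda U\}$. It is assumed that $\|\cdot\|$ is a norm, that $X$ is complete for it, and that $X_+$ is closed. Norms of operators are operator norms. The abstract state space is strong if $U$ is radially compact, i.e. $\ell\cap U$ is a closed and bounded segment for every line $\ell$ through the origin; equivalently, $U$ is the closed unit ball of $X$. A linear operator $T:X\to X$ is Markov if it is positive ($Tx\ge0$ whenever $x\ge 0$) and $T(\mathcal K)\subset\mathcal K$. A $C_0$-Markov semigroup is a strongly continuous one-parameter semigroup $(T_t)_{t\ge0}$ on $X$ ($T_0=I$, $T_{t+s}=T_tT_s$,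 $\|T_tx-x\|\to0$ as $t\downarrow0$ for every $x\in X$) such that every $T_t$ is Markov. Averages: $A_t(\mathcal T)=\frac1t\int_0^tT_s\,ds$ for $t>0$, the integral being taken in the strong operator topology. For $y\in X$, $T_y:X\to X$ denotes the operator $T_y(x)=f(x)y$. Dobrushin's ergodicity coefficient of a Markov operator $T$: with $N=\{x\in X: f(x)=0\}$, $\delta(T)=\sup_{x\in N,\,x\ne0}\|Tx\|/\|x\|$. *)

(* Defs.v *)
(* Stdlib reals with Coquelicot: [RInt] is the Riemann integral of functions
   with values in a complete normed module. *)
From Stdlib Require Import Reals.
From Coquelicot Require Import Coquelicot.

Open Scope R_scope.

Definition linear_map {V W : ModuleSpace R_AbsRing} (T : V -> W) : Prop :=
  (forall x y, T (plus x y) = plus (T x) (T y)) /\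
  (forall (a : R) x, T (scal a x) = scal a (T x)).

Section Order.

Context {X : ModuleSpace R_AbsRing}.

Definition convex (C : X -> Prop) : Prop :=
  forall x y (a : R), C x -> C y -> 0 <= a <= 1 ->
    C (plus (scal a x) (scal (1 - a) y)).

Definition convex_hull (A : X -> Prop) (x : X) : Prop :=
  forall C : X -> Prop, convex C -> (forall y, A y -> C y) -> C x.

Definition cone (P : X -> Prop) : Prop :=
  P zero /\
  (forall x y, P x -> P y -> P (plus x y)) /\
  (forall (a : R) x, 0 <= a -> P x -> P (scal a x)) /\
  (forall x, P x -> P (opp x) -> x = zero).

Definition generating (P : X -> Prop) : Prop :=
  forall x, exists y z, P y /\ P z /\ x = minus y z.

Definition base (P : X -> Prop) (f : X -> R) (x : X) : Prop :=
  P x /\ f x = 1.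

Definition base_ball (P : X -> Prop) (f : X -> R) : X -> Prop :=
  convex_hull (fun x => base P f x \/ base P f (opp x)).

(* Lines through the origin are R x with x <> 0; the trace of U on R x is
   described by the parameters t with t x in U. *)
Definition radially_compact (U : X -> Prop) : Prop :=
  forall x, x <> zero ->
    exists a b : R, a <= b /\ forall t : R, U (scal t x) <-> a <= t <= b.

(* The infimum is taken in Rbar: it is p_infty when x lies in no multiple of U. *)
Definition gauge (U : X -> Prop) (x : X) : Rbar :=
  Glb_Rbar (fun l => 0 <= l /\ exists u, U u /\ x = scal l u).

Definition Markov (P : X -> Prop) (f : X -> R) (T : X -> X) : Prop :=
  linear_map T /\
  (forall x, P x -> P (T x)) /\
  (forall x, base P f x -> base P f (T x)).

Definition rank_one (f : X -> R) (y : X) : X -> X := fun x => scal (f x) y.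

End Order.

(* The gauge of U is required to be the norm of the complete normed module X,
   which says at once that it is a (finite) norm and that X is complete for it.
   In particular base P f is nonempty and X is not {0}, since the gauge of the
   empty set is p_infty everywhere. *)
Definition abstract_state_space {X : CompleteNormedModule R_AbsRing}
    (P : X -> Prop) (f : X -> R) : Prop :=
  cone P /\ generating P /\
  linear_map (f : X -> R_ModuleSpace) /\
  (forall x, P x -> x <> zero -> 0 < f x) /\
  (forall x, gauge (base_ball P f) x = Finite (norm x)) /\
  closed P.

Definition strong_abstract_state_space {X : CompleteNormedModule R_AbsRing}
    (P : X -> Prop) (f : X -> R) : Prop :=
  abstract_state_space P f /\ radially_compact (base_ball P f).

Section Semigroups.

Context {X : CompleteNormedModule R_AbsRing}.

(* Semigroups are indexed by R; only their values at times t >= 0 matter. *)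
Definition C0_semigroup (T : R -> X -> X) : Prop :=
  (forall x, T 0 x = x) /\
  (forall t s, 0 <= t -> 0 <= s -> forall x, T (t + s) x = T t (T s x)) /\
  (forall x, filterlim (fun t => norm (minus (T t x) x))
               (at_right 0) (locally 0)).

Definition C0_Markov_semigroup (P : X -> Prop) (f : X -> R)
    (T : R -> X -> X) : Prop :=
  C0_semigroup T /\ forall t, 0 <= t -> Markov P f (T t).

(* Integration in the strong operator topology is pointwise integration. *)
Definition average (T : R -> X -> X) (t : R) : X -> X :=
  fun x => scal (/ t) (RInt (fun s => T s x) 0 t).

Definition operator_norm (T : X -> X) : Rbar :=
  Lub_Rbar (fun r => exists x, norm x <= 1 /\ r = norm (T x)).

(* If the kernel of f is {0}, this is the supremum of the empty set, m_infty,
   instead of the conventional value 0; both are < 1. *)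
Definition dobrushin (f : X -> R) (T : X -> X) : Rbar :=
  Lub_Rbar (fun r => exists x, f x = 0 /\ x <> zero /\ r = norm (T x) / norm x).

(* Suprema are kept in Rbar, so that an unbounded set never has a finite
   supremum; this is convergence to 0 of a function with values in Rbar. *)
Definition vanishes_at_infinity (g : R -> Rbar) : Prop :=
  forall eps : R, 0 < eps ->
    Rbar_locally p_infty (fun t => Rbar_lt (Rbar_abs (g t)) eps).

Definition weakly_mean_ergodic (P : X -> Prop) (f : X -> R)
    (T : R -> X -> X) : Prop :=
  vanishes_at_infinity (fun t =>
    Lub_Rbar (fun r => exists x y, base P f x /\ base P f y /\
      r = norm (minus (average T t x) (average T t y)))).

Definition uniformly_mean_ergodic (P : X -> Prop) (f : X -> R)
    (T : R -> X -> X) : Prop :=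
  exists x0, base P f x0 /\
    vanishes_at_infinity (fun t =>
      operator_norm (fun x => minus (average T t x) (rank_one f x0 x))).

End Semigroups.

(* Main.v *)
Require Import Defs.
From Stdlib Require Import Reals Lra Lia Classical ssreflect.
From Coquelicot Require Import Coquelicot.

Open Scope R_scope.

(** Every [x] with [norm x < l] is a difference [p - q] of elements of the cone with
    [f p + f q < l], so Markov operators are contractions, and on the kernel of [f]
    the norm of [A z] is at most [norm z / 2] times the diameter of the image of the
    base: this gives (i) -> (ii). For (ii) -> (iii), [A_t0] contracts the kernel of
    [f] by some [d < 1], hence has a fixed point [x0] in the base (geometric series),
    unique and therefore fixed by all averages, since they commute with [A_t0].
    From [norm (A_t (A_t0 z) - A_t z) <= 2 t0 / t * norm z], any bound [m] for [A_t]
    on the kernel improves to [2 t0 / t + d m], so in the limit [A_t] is bounded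
    there by [2 t0 / (t (1 - d))], and [A_t x - f x x0 = A_t (x - f x x0)]. *)

(** * Linear maps, Riemann integrals and the hull [base_ball] *)

Lemma scal_inv_r {V : ModuleSpace R_AbsRing} (c : R) (x : V) :
  c <> 0 -> scal c (scal (/ c) x) = x.
Proof.
  move=> Hc; rewrite scal_assoc /mult /= Rinv_r //; exact: scal_one.
Qed.

Lemma linear_map_minus {V W : ModuleSpace R_AbsRing} (A : V -> W) x y : linear_map A ->
  A (minus x y) = minus (A x) (A y).
Proof.
  by move=> [Ap As]; rewrite /minus Ap -scal_opp_one As scal_opp_one.
Qed.

Lemma linear_map_is_linear {V W : NormedModule R_AbsRing} (L : V -> W) (M : R) :
  0 < M -> linear_map L -> (forall x, norm (L x) <= M * norm x) -> is_linear L.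
Proof.
  move=> M0 [Hp Hs] Hn; apply: Build_is_linear => //.
  by exists M.
Qed.

Lemma Riemann_sum_linear {V W : NormedModule R_AbsRing} (L : V -> W) (g : R -> V)
    (ptd : SF_seq) :
  is_linear L -> Riemann_sum (fun s => L (g s)) ptd = L (Riemann_sum g ptd).
Proof.
  move=> HL; induction ptd as [x0 | h s IH] using SF_cons_ind.
  - by rewrite /Riemann_sum /= linear_zero.
  - by rewrite !Riemann_sum_cons IH (linear_plus _ HL) (linear_scal _ HL).
Qed.

Lemma is_RInt_linear {V W : NormedModule R_AbsRing} (L : V -> W) (g : R -> V)
    (a b : R) (I : V) :
  is_linear L -> is_RInt g a b I -> is_RInt (fun s => L (g s)) a b (L I).
Proof.
  move=> HL Hg; rewrite /is_RInt.
  apply: (filterlim_ext (fun ptd => L (scal (sign (b - a)) (Riemann_sum g ptd)))).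
  - by move=> ptd; rewrite (Riemann_sum_linear L g) //; exact: (linear_scal _ HL).
  - exact: (filterlim_comp _ _ _ _ _ _ _ _ Hg (linear_cont L I HL)).
Qed.

(** Riemann sums are nonnegative combinations of values of the integrand, so they stay in the cone,
    and closedness keeps their limit there. *)
Lemma is_RInt_closed_cone {V : NormedModule R_AbsRing} (P : V -> Prop) (g : R -> V)
    (a b : R) (I : V) :
  cone P -> closed P -> a <= b -> (forall s, a <= s <= b -> P (g s)) ->
  is_RInt g a b I -> P I.
Proof.
  move=> [P0 [Padd [Pscal _]]] Pcl Hab Hg HI.
  (* Clipping [g] makes it [P]-valued everywhere, whatever the tags of the subdivision. *)
  pose g' s := g (Rmax a (Rmin b s)).
  have Hg' : forall s, P (g' s).
  { move=> s; apply: Hg; rewrite /Rmax /Rmin.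
    repeat case: Rle_dec; lra. }
  have HI' : is_RInt g' a b I.
  { apply: (is_RInt_ext g) HI => s; rewrite Rmin_left // Rmax_right // => Hs.
    by rewrite /g' Rmin_right; [|lra]; rewrite Rmax_right; [|lra]. }
  apply: (closed_filterlim_loc _ _ _ HI') Pcl.
  (* Any mesh bound will do: only the orientation of the subdivision is used. *)
  exists (mkposreal 1 Rlt_0_1) => ptd _ [Hptd _].
  (* The approximants carry the factor [sign (b - a)], which is 0 or 1 here. *)
  apply: (Pscal _ _).
  { case: Hab => Hab; last first.
    - by rewrite Hab Rminus_diag sign_0; apply Rle_refl.
    - by rewrite sign_eq_1; lra. }
  clear HI HI'; induction ptd as [x0 | h s IH] using SF_cons_ind.
  - exact: P0.
  - rewrite Riemann_sum_cons; apply: Padd; last by apply: IH; exact: ptd_cons Hptd.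
    apply: Pscal => //.
    have := Hptd 0%nat; rewrite /SF_size /=.
    have H0 : (0 < S (length (SF_t s)))%nat by lia.
    move=> /(_ H0) /= H; lra.
Qed.

(** The set of all such differences is convex and contains the base and its negative, so it contains
    their convex hull. *)
Lemma base_ball_of_cone {X : ModuleSpace R_AbsRing} (P : X -> Prop) (f : X -> R) u :
  cone P -> linear_map (f : X -> R_ModuleSpace) -> base_ball P f u ->
  exists p q, P p /\ P q /\ u = minus p q /\ f p + f q = 1.
Proof.
  move=> [P0 [Padd [Pscal _]]] [fp fs].
  have f0 : f zero = 0.
  { have := fs 0 zero; rewrite scal_zero_r => ->. exact: Rmult_0_l. }
  move=> /(_ (fun u => exists p q, P p /\ P q /\ u = minus p q /\ f p + f q = 1)).
  apply.
  - move=> x y a [p [q [Hp [Hq [-> E]]]]] [p' [q' [Hp' [Hq' [-> E']]]]] Ha.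
    exists (plus (scal a p) (scal (1 - a) p')), (plus (scal a q) (scal (1 - a) q')).
    split; first by apply: Padd; apply: Pscal => //; lra.
    split; first by apply: Padd; apply: Pscal => //; lra.
    split.
    + rewrite /minus !scal_distr_l opp_plus !scal_opp_r -!plus_assoc; f_equal.
      rewrite !plus_assoc; f_equal; exact: plus_comm.
    + rewrite !fp !fs /plus /scal /= /mult /=.
      have -> : f q = 1 - f p by lra.
      have -> : f q' = 1 - f p' by lra.
      ring.
  - move=> y [[Py E]|[Py E]].
    + exists y, zero; rewrite minus_zero_r f0; repeat split => //; lra.
    + exists zero, (opp y); rewrite /minus plus_zero_l opp_opp f0; repeat split => //; lra.
Qed.

(** * Norm, functional and Markov operators of an abstract state space *)

Section StateSpace.

Context {X : CompleteNormedModule R_AbsRing} {P : X -> Prop} {f : X -> R}.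
Context (HX : abstract_state_space P f).

Lemma functional_plus x y : f (plus x y) = f x + f y.
Proof. by case: HX => [_ [_ [[H _] _]]]; exact: H. Qed.

Lemma functional_scal a x : f (scal a x) = a * f x.
Proof. by case: HX => [_ [_ [[_ H] _]]]; exact: H. Qed.

Lemma functional_zero : f zero = 0.
Proof. by rewrite -(scal_zero_l zero) functional_scal; exact: Rmult_0_l. Qed.

Lemma functional_opp x : f (opp x) = - f x.
Proof.
  have := functional_plus x (opp x); rewrite plus_opp_r functional_zero; lra.
Qed.

Lemma functional_minus x y : f (minus x y) = f x - f y.
Proof. by rewrite /minus functional_plus functional_opp. Qed.

Lemma functional_nonneg p : P p -> 0 <= f p.
Proof.
  case: HX => [_ [_ [_ [fpos _]]]] Pp.
  case: (classic (p = zero)) => [->|Hp].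
  - rewrite functional_zero; lra.
  - by apply: Rlt_le; exact: fpos.
Qed.

Lemma functional_eq_zero p : P p -> f p = 0 -> p = zero.
Proof.
  case: HX => [_ [_ [_ [fpos _]]]] Pp E.
  apply: NNPP => Hp; have := fpos _ Pp Hp; lra.
Qed.

Lemma norm_le_scaled_base_ball l u : 0 <= l -> base_ball P f u -> norm (scal l u) <= l.
Proof.
  case: HX => [_ [_ [_ [_ [Hg _]]]]] Hl Hu.
  have [H _] := Glb_Rbar_correct
    (fun l' => 0 <= l' /\ exists v, base_ball P f v /\ scal l u = scal l' v).
  have := H l; rewrite -/(gauge _ _) Hg /=; apply.
  by split => //; exists u.
Qed.

Lemma scal_inv_functional_base p : P p -> f p <> 0 -> base P f (scal (/ f p) p).
Proof.
  case: HX => [[_ [_ [Ps _]]] _] Hp fp0; split.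
  - apply: Ps => //; apply: Rlt_le; apply: Rinv_0_lt_compat.
    have := functional_nonneg p Hp; lra.
  - by rewrite functional_scal Rinv_l.
Qed.

Lemma norm_cone p : P p -> norm p <= f p.
Proof.
  move=> Pp; case: (Req_dec (f p) 0) => [E|E].
  - rewrite E (functional_eq_zero p) // norm_zero; exact: Rle_refl.
  - rewrite -{1}(scal_inv_r (f p) p E); apply: norm_le_scaled_base_ball.
    + exact: functional_nonneg.
    + move=> C _; apply; left; exact: scal_inv_functional_base.
Qed.

Lemma norm_cone_minus p q : P p -> P q -> norm (minus p q) <= f p + f q.
Proof.
  move=> Hp Hq; apply: Rle_trans (norm_triangle _ _) _; rewrite norm_opp.
  by apply: Rplus_le_compat; apply: norm_cone.
Qed.

(** The infimum defining the gauge need not be attained, hence the strict inequality: if no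
    admissible multiple were below [l], then [l] would be a lower bound larger than the infimum. *)
Lemma base_ball_decomposition x l : norm x < l ->
  exists l' u, 0 <= l' < l /\ base_ball P f u /\ x = scal l' u.
Proof.
  move=> Hl; case: (HX) => [_ [_ [_ [_ [Hg _]]]]].
  have [_ H] := Glb_Rbar_correct
    (fun l => 0 <= l /\ exists v, base_ball P f v /\ x = scal l v).
  rewrite -/(gauge _ _) Hg in H.
  apply: NNPP => Hn; apply: (Rlt_not_le _ _ Hl); apply: (H (Finite l)).
  move=> l' [Hl' [u Hu]] /=; apply: Rnot_lt_le => Hlt; apply: Hn; by exists l', u.
Qed.

Lemma cone_decomposition x l : norm x < l ->
  exists p q, P p /\ P q /\ x = minus p q /\ f p + f q < l.
Proof.
  case: (HX) => [HP [_ [Hf _]]].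
  move=> /base_ball_decomposition [l' [u [[Hl' Hll] [Hu E]]]].
  case: (base_ball_of_cone P f u HP Hf Hu) => p [q [Hp [Hq [Eu Es]]]].
  case: (HP) => [_ [_ [Ps _]]].
  exists (scal l' p), (scal l' q); repeat split; try by apply: Ps.
  - by rewrite E Eu scal_minus_distr_l.
  - rewrite !functional_scal -Rmult_plus_distr_l Es; lra.
Qed.

(** Finiteness of the gauge at [zero] yields a point [minus p q] of the ball; since [f p + f q = 1],
    one of [p], [q] can be normalised. *)
Lemma base_nonempty : exists u, base P f u.
Proof.
  case: (HX) => [HP [_ [Hf _]]].
  have H1 : norm (zero : X) < 1 by rewrite norm_zero; lra.
  case: (base_ball_decomposition _ _ H1) => l' [u [_ [Hu _]]].
  case: (base_ball_of_cone P f u HP Hf Hu) => p [q [Hp [Hq [_ Es]]]].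
  case: (Req_dec (f p) 0) => [E|E].
  - exists (scal (/ f q) q); apply: scal_inv_functional_base => //; lra.
  - exists (scal (/ f p) p); exact: scal_inv_functional_base.
Qed.

(** Otherwise [x] splits as [minus p q] with [f p + f q < Rabs (f x)], although
    [Rabs (f p - f q) <= f p + f q]. *)
Lemma functional_norm x : Rabs (f x) <= norm x.
Proof.
  apply: Rnot_lt_le => /cone_decomposition [p [q [Hp [Hq [E Hl]]]]].
  move: Hl; rewrite E functional_minus.
  have := functional_nonneg p Hp; have := functional_nonneg q Hq.
  rewrite /Rabs; case: Rcase_abs; lra.
Qed.

Lemma functional_is_linear : is_linear (f : X -> R_NormedModule).
Proof.
  case: (HX) => [_ [_ [Hf _]]].
  apply: (linear_map_is_linear _ 1 Rlt_0_1 Hf) => x.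
  rewrite Rmult_1_l; exact: functional_norm.
Qed.

Lemma closed_base : closed (base P f).
Proof.
  case: (HX) => [_ [_ [_ [_ [_ Pcl]]]]].
  apply: closed_and => //.
  apply: (closed_comp (f : X -> R_UniformSpace) (fun r => r = 1)).
  - move=> x; exact: linear_cont functional_is_linear.
  - exact: closed_eq.
Qed.

Lemma norm_base x : base P f x -> norm x <= 1.
Proof. by case=> Px <-; exact: norm_cone. Qed.

Lemma Markov_functional_cone A p : Markov P f A -> P p -> f (A p) = f p.
Proof.
  move=> [[_ As] [_ Ab]] Pp; case: (Req_dec (f p) 0) => [E|E].
  - rewrite (functional_eq_zero p) // -(scal_zero_l zero) As !scal_zero_l //.
  - rewrite -{1}(scal_inv_r (f p) p E) As functional_scal.
    by case: (Ab _ (scal_inv_functional_base p Pp E)) => _ ->; rewrite Rmult_1_r.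
Qed.

Lemma Markov_functional A x : Markov P f A -> f (A x) = f x.
Proof.
  move=> HA; case: (HX) => [_ [Hgen _]]; case: (Hgen x) => p [q [Hp [Hq ->]]].
  rewrite (linear_map_minus A) ?functional_minus; last by case: HA.
  by rewrite !Markov_functional_cone.
Qed.

(** [A] carries a cone decomposition of [x] to one of [A x] with the same values of [f]. If
    [norm x < norm (A x)], decomposing [x] with [l := norm (A x)] would give
    [norm (A x) < norm (A x)]. *)
Lemma Markov_norm A x : Markov P f A -> norm (A x) <= norm x.
Proof.
  move=> HA; apply: Rnot_lt_le => /cone_decomposition [p [q [Hp [Hq [E Hl]]]]].
  case: (HA) => [HL [HP _]].
  apply: (Rlt_irrefl (norm (A x))); apply: Rle_lt_trans Hl.
  rewrite {1}E linear_map_minus //.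
  rewrite -(Markov_functional_cone A p) // -(Markov_functional_cone A q) //.
  by apply: norm_cone_minus; apply: HP.
Qed.

Lemma Markov_is_linear A : Markov P f A -> is_linear A.
Proof.
  move=> HA; apply: (linear_map_is_linear _ 1 Rlt_0_1); first by case: HA.
  by move=> x; rewrite Rmult_1_l; exact: Markov_norm.
Qed.

(** If [z = minus p q] and [f z = 0], then [f p = f q], so [z] is [f p] times a difference of two
    base points. The factor 1/2 comes from [2 * f p = f p + f q < l], where [l] is any number above
    [norm z]. *)
Lemma norm_kernel_le (A : X -> X) M z : linear_map A ->
  (forall u v, base P f u -> base P f v -> norm (minus (A u) (A v)) <= M) ->
  f z = 0 -> norm (A z) <= M / 2 * norm z.
Proof.
  move=> HA HM Hz.
  have M0 : 0 <= M.
  { case: base_nonempty => u Hu; apply: Rle_trans (HM _ _ Hu Hu); exact: norm_ge_0. }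
  have Hl : forall l, norm z < l -> norm (A z) <= M / 2 * l.
  { move=> l /cone_decomposition [p [q [Hp [Hq [E Hl]]]]].
    have Epq : f p = f q by move: Hz; rewrite E functional_minus; lra.
    have Hp0 := functional_nonneg p Hp.
    case: (Req_dec (f p) 0) => [Ep|Ep].
    - have -> : z = zero.
      { by rewrite E (functional_eq_zero p) // (functional_eq_zero q) ?minus_eq_zero //; lra. }
      rewrite -(scal_zero_l zero) (proj2 HA) scal_zero_l norm_zero.
      apply: Rmult_le_pos; lra.
    - have Bp := scal_inv_functional_base p Hp Ep.
      have Bq : base P f (scal (/ f q) q) by apply: scal_inv_functional_base => //; lra.
      have -> : A z = scal (f p) (minus (A (scal (/ f p) p)) (A (scal (/ f q) q))).
      { rewrite -linear_map_minus // -(proj2 HA) scal_minus_distr_l {3}Epq.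
        by rewrite (scal_inv_r _ p) // (scal_inv_r _ q) -?Epq -?E. }
      apply: Rle_trans (norm_scal _ _) _.
      rewrite /abs /= Rabs_pos_eq //.
      have := HM _ _ Bp Bq; nra. }
  apply: Rnot_lt_le => Hlt.
  (* Dividing by [M + 1] is safe even for [M = 0], and [M / 2 * e] is then smaller than the gap to
     be contradicted. *)
  pose e := (norm (A z) - M / 2 * norm z) / (M + 1).
  have He : 0 < e by apply: Rdiv_lt_0_compat; lra.
  have E : (M + 1) * e = norm (A z) - M / 2 * norm z by rewrite /e; field; lra.
  have := Hl (norm z + e); nra.
Qed.

(** Increments of the orbit of a base point lie in the kernel of [f], so they decay geometrically
    and the orbit converges. Its limit stays in the closed base and is fixed by continuity of
    [A]. *)
Lemma Markov_contraction_fixed_point (A : X -> X) d : Markov P f A -> 0 <= d < 1 ->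
  (forall z, f z = 0 -> norm (A z) <= d * norm z) ->
  exists x0, base P f x0 /\ A x0 = x0.
Proof.
  move=> HA Hd Hc; case: base_nonempty => u Hu.
  have HL := Markov_is_linear A HA.
  pose w n := Nat.iter n A u.
  pose a n := minus (w (S n)) (w n).
  have Ha : forall n, f (a n) = 0 /\ norm (a n) <= norm (a 0%nat) * d ^ n.
  { elim=> [|n [IHf IHn]].
    - rewrite functional_minus /= Markov_functional //; split; lra.
    - have -> : a (S n) = A (a n) by rewrite /a (linear_minus A).
      rewrite Markov_functional //; split => //.
      apply: Rle_trans (Hc _ IHf) _.
      have := Rmult_le_compat_l d _ _ (proj1 Hd) IHn; simpl; lra. }
  (* From here on [S] is the sum of the series; the successor becomes [Datatypes.S]. *)
  have [S HS] : ex_series a.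
  { apply: (ex_series_le _ (fun n => norm (a 0%nat) * d ^ n)).
    - by move=> n; exact: (proj2 (Ha n)).
    - apply: (ex_series_scal_l (norm (a 0%nat)) (fun n => d ^ n)).
      apply: ex_series_geom; rewrite Rabs_pos_eq; lra. }
  (* The sum telescopes; it includes the term of index [n], hence the iterate of index [n + 1]. *)
  have Hsum : forall n, plus (sum_n a n) u = w (Datatypes.S n).
  { elim=> [|n IH].
    - by rewrite sum_O /a /minus -plus_assoc plus_opp_l plus_zero_r.
    - rewrite sum_Sn plus_comm plus_assoc (plus_comm u) IH /a /minus.
      by rewrite (plus_comm (w (Datatypes.S n))) -plus_assoc plus_opp_l plus_zero_r. }
  pose x0 := plus S u.
  have Hw : filterlim (fun n => w (Datatypes.S n)) eventually (locally x0).
  { apply: (filterlim_ext _ _ Hsum).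
    exact: (filterlim_comp_2 _ _ _ HS (filterlim_const u) (filterlim_plus S u)). }
  have Hb : forall n, base P f (w n).
  { elim=> [|n IH] //=; exact: (proj2 (proj2 HA)). }
  exists x0; split.
  - apply: (closed_filterlim _ _ _ Hw) => //; exact: closed_base.
  (* The twice shifted orbit tends to [A x0] by continuity and to [x0] as a subsequence. *)
  - have H1 : filterlim (fun n => w (Datatypes.S (Datatypes.S n))) eventually (locally (A x0)).
    { exact: (filterlim_comp _ _ _ _ A _ _ _ Hw (linear_cont A x0 HL)). }
    have H2 : filterlim (fun n => w (Datatypes.S (Datatypes.S n))) eventually (locally x0).
    { have HS' : filterlim Datatypes.S eventually eventually.
      { by apply: eventually_subseq => n; lia. }
      exact: (filterlim_comp _ _ _ _ _ _ _ _ HS' Hw). }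
    exact (@filterlim_locally_unique nat R_AbsRing X eventually _ _ _ _ H1 H2).
Qed.

End StateSpace.

(** * Integrals and averages of a Markov semigroup *)

Section MarkovSemigroup.

Context {X : CompleteNormedModule R_AbsRing} {P : X -> Prop} {f : X -> R}.
Context {T : R -> X -> X}.
Context (HX : abstract_state_space P f) (HT : C0_Markov_semigroup P f T).

Lemma semigroup_Markov t : 0 <= t -> Markov P f (T t).
Proof. by case: HT => _; exact. Qed.

Lemma semigroup_add t s x : 0 <= t -> 0 <= s -> T (t + s) x = T t (T s x).
Proof. by move=> Ht Hs; case: HT => [[_ [H _]] _]; exact: H. Qed.

(** The operator at the smaller of the two times factors out of the difference and is a contraction.
    This reduces continuity of orbits to strong continuity at 0. *)
Lemma norm_orbit_minus t s x : 0 <= t -> 0 <= s ->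
  norm (minus (T t x) (T s x)) <= norm (minus (T (Rabs (t - s)) x) x).
Proof.
  have H : forall t s, 0 <= s <= t ->
      norm (minus (T t x) (T s x)) <= norm (minus (T (Rabs (t - s)) x) x).
  { move=> {t s} t s Hst; rewrite Rabs_pos_eq; last lra.
    have -> : T t x = T s (T (t - s) x).
    { by rewrite -semigroup_add; [f_equal; lra | lra | lra]. }
    have HM : Markov P f (T s) by apply: semigroup_Markov; lra.
    rewrite -linear_map_minus; last by case: HM.
    exact: (Markov_norm HX). }
  move=> Ht Hs; case: (Rle_dec s t) => Hst; first by apply: H.
  rewrite -norm_opp opp_minus Rabs_minus_sym; apply: H; lra.
Qed.

(* [Rmax 0 r] hides the unspecified operators [T r] with [r < 0], so that
   continuity is two-sided also at [0]. *)
Lemma orbit_continuous x s : continuous (fun r => T (Rmax 0 r) x) s.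
Proof.
  apply/filterlim_locally_ball_norm => eps.
  case: (HT) => [[T0 [_ Hc]] _].
  case: (proj1 (filterlim_locally _ _) (Hc x) eps) => d Hd.
  exists d => r Hr; rewrite /ball_norm.
  apply: Rle_lt_trans (norm_orbit_minus _ _ x (Rmax_l _ _) (Rmax_l _ _)) _.
  set h := Rabs _.
  have Hh : h <= Rabs (r - s).
  { rewrite /h /Rmax; repeat case: Rle_dec => ?; rewrite /Rabs;
      repeat case: Rcase_abs => ?; lra. }
  have h0 : 0 <= h by exact: Rabs_pos.
  (* The filter [at_right 0] excludes the point 0 itself, so [h = 0] is treated through
     [T 0 x = x]. *)
  case: (Req_dec h 0) => [->|hn].
  - rewrite T0 minus_eq_zero norm_zero; exact: cond_pos.
  - have Hb : ball 0 d h.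
    { rewrite /ball /= /AbsRing_ball /abs /minus /plus /opp /= Ropp_0 Rplus_0_r.
      rewrite Rabs_pos_eq //; apply: Rle_lt_trans Hh _; exact: Hr. }
    have h1 : 0 < h by lra.
    have := Hd _ Hb h1.
    rewrite /ball /= /AbsRing_ball /abs /minus /plus /opp /= Ropp_0 Rplus_0_r.
    rewrite Rabs_pos_eq //; exact: norm_ge_0.
Qed.

Lemma ex_RInt_orbit x a b : 0 <= a -> 0 <= b -> ex_RInt (fun s => T s x) a b.
Proof.
  move=> Ha Hb; apply: (ex_RInt_ext (fun r => T (Rmax 0 r) x)).
  - move=> r [Hr _]; rewrite Rmax_right //.
    have := Rmin_glb _ _ _ Ha Hb; lra.
  - by apply: ex_RInt_continuous => r _; exact: orbit_continuous.
Qed.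

Lemma is_RInt_orbit x t : 0 <= t ->
  is_RInt (fun s => T s x) 0 t (RInt (fun s => T s x) 0 t).
Proof. by move=> Ht; apply: RInt_correct; apply: ex_RInt_orbit => //; lra. Qed.

Lemma average_linear t : 0 < t -> linear_map (average T t).
Proof.
  move=> Ht.
  have H0 x : ex_RInt (fun s => T s x) 0 t by apply: ex_RInt_orbit; lra.
  have HM s : Rmin 0 t < s < Rmax 0 t -> linear_map (T s).
  { rewrite Rmin_left ?Rmax_right; try lra; move=> Hs.
    have : Markov P f (T s) by apply: semigroup_Markov; lra.
    by case. }
  split=> [x y|a x]; rewrite /average.
  - rewrite -scal_distr_l -RInt_plus //; f_equal.
    by apply: RInt_ext => s /HM [H _]; exact: H.
  - rewrite (RInt_ext _ (fun s => scal a (T s x))).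
    + rewrite RInt_scal // !scal_assoc; f_equal; exact: Rmult_comm.
    + by move=> s /HM [_ H]; exact: H.
Qed.

(** Positivity passes through the integral because the cone is closed. The continuous functional [f]
    also passes through it, and on an orbit starting in the base it is constantly 1. *)
Lemma average_Markov t : 0 < t -> Markov P f (average T t).
Proof.
  move=> Ht.
  have HP x : P x -> P (average T t x).
  { move=> Px; case: (HX) => [[P0 [Pa [Ps Pp]]] [_ [_ [_ [_ Pcl]]]]].
    apply: (Ps); first by apply: Rlt_le; exact: Rinv_0_lt_compat.
    apply: (is_RInt_closed_cone P (fun s => T s x) 0 t) => //.
    - lra.
    - move=> s [Hs _]; case: (semigroup_Markov s Hs) => _ [H _]; exact: H.
    - apply: is_RInt_orbit; lra. }
  split; [exact: average_linear|split=> // x [Px Ex]].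
  split; first exact: HP.
  rewrite /average (functional_scal HX).
  have -> : f (RInt (fun s => T s x) 0 t) = t.
  { have Hi : is_RInt (fun s => f (T s x)) 0 t (f (RInt (fun s => T s x) 0 t)).
    { apply: (is_RInt_linear (f : X -> R_NormedModule)).
      - exact: functional_is_linear HX.
      - apply: is_RInt_orbit; lra. }
    rewrite -(is_RInt_unique _ _ _ _ Hi) (RInt_ext _ (fun _ => 1)).
    - rewrite RInt_const /scal /= /mult /=; ring.
    - move=> s; rewrite Rmin_left ?Rmax_right; try lra; move=> Hs.
      rewrite (Markov_functional HX) //; apply: semigroup_Markov; lra. }
  field; lra.
Qed.

Lemma average_commutes A t x : 0 < t -> is_linear A ->
  (forall s y, 0 <= s -> A (T s y) = T s (A y)) ->
  average T t (A x) = A (average T t x).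
Proof.
  move=> Ht HA Hc; rewrite /average (linear_scal _ HA); f_equal.
  apply: is_RInt_unique; apply: (is_RInt_ext (fun s => A (T s x))).
  - by move=> s; rewrite Rmin_left ?Rmax_right; try lra; move=> Hs; apply: Hc; lra.
  - by apply: is_RInt_linear => //; apply: is_RInt_orbit; lra.
Qed.

Lemma norm_RInt_orbit x a b : 0 <= a <= b ->
  norm (RInt (fun s => T s x) a b) <= (b - a) * norm x.
Proof.
  move=> Hab; apply: (norm_RInt_le_const (fun s => T s x) a b); first lra.
  - move=> s Hs; apply: (Markov_norm HX); apply: semigroup_Markov; lra.
  - by apply: RInt_correct; apply: ex_RInt_orbit; lra.
Qed.

(** The integrals over [[s, t + s]] and [[0, t]] differ only by two end pieces of length [s], each
    of norm at most [s * norm x]. *)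
Lemma norm_average_shift t s x : 0 < t -> 0 <= s ->
  norm (minus (average T t (T s x)) (average T t x)) <= 2 * s / t * norm x.
Proof.
  move=> Ht Hs.
  pose g := fun r => T r x.
  have Hg a b : 0 <= a -> 0 <= b -> ex_RInt g a b by exact: ex_RInt_orbit.
  have Es : RInt (fun r => T r (T s x)) 0 t = RInt g s (t + s).
  { rewrite (RInt_ext _ (fun r => scal 1 (g (1 * r + s)))).
    - rewrite RInt_comp_lin.
      + f_equal; ring.
      + apply: Hg; lra.
    - move=> r; rewrite Rmin_left ?Rmax_right; try lra; move=> Hr.
      rewrite scal_one /g Rmult_1_l semigroup_add //; lra. }
  have Ed : minus (RInt g s (t + s)) (RInt g 0 t) =
            minus (RInt g t (t + s)) (RInt g 0 s).
  { have E1 : plus (RInt g 0 s) (RInt g s (t + s)) = RInt g 0 (t + s).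
    { by apply: RInt_Chasles; apply: Hg; lra. }
    have E2 : plus (RInt g 0 t) (RInt g t (t + s)) = RInt g 0 (t + s).
    { by apply: RInt_Chasles; apply: Hg; lra. }
    (* With the integral over [[0, s]] added, both sides equal the integral over [[t, t + s]]. *)
    apply: (plus_reg_l (RInt g 0 s)); rewrite /minus plus_assoc E1 -E2.
    rewrite (plus_comm (RInt g 0 t)) -plus_assoc plus_opp_r plus_zero_r.
    by rewrite plus_comm -plus_assoc plus_opp_l plus_zero_r. }
  rewrite /average -scal_minus_distr_l Es Ed.
  apply: Rle_trans (norm_scal _ _) _; rewrite /abs /=.
  rewrite Rabs_pos_eq; last by apply: Rlt_le; exact: Rinv_0_lt_compat.
  have H1 : 0 <= t <= t + s by lra.
  have H2 : 0 <= 0 <= s by lra.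
  have := norm_RInt_orbit x _ _ H1; have := norm_RInt_orbit x _ _ H2; rewrite -/g => H3 H4.
  have -> : 2 * s / t * norm x = / t * (2 * s * norm x) by field; lra.
  apply: Rmult_le_compat_l; first by apply: Rlt_le; exact: Rinv_0_lt_compat.
  apply: Rle_trans (norm_triangle _ _) _; rewrite norm_opp; lra.
Qed.

(** The difference is itself the mean over [s] in [[0, t0]] of the shift differences, each bounded
    by [2 * s / t * norm x] with [s <= t0]. *)
Lemma norm_average_average t t0 x : 0 < t -> 0 < t0 ->
  norm (minus (average T t (average T t0 x)) (average T t x)) <= 2 * t0 / t * norm x.
Proof.
  move=> Ht Ht0; pose A := average T t.
  have HL : is_linear A by apply: (Markov_is_linear HX); exact: average_Markov.
  pose I := RInt (fun s => T s x) 0 t0.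
  have Hi : is_RInt (fun s => minus (A (T s x)) (A x)) 0 t0
              (minus (A I) (scal (t0 - 0) (A x))).
  { apply: is_RInt_minus; last exact: is_RInt_const.
    by apply: is_RInt_linear => //; apply: is_RInt_orbit; lra. }
  have -> : minus (A (average T t0 x)) (A x) =
            scal (/ t0) (minus (A I) (scal (t0 - 0) (A x))).
  { rewrite scal_minus_distr_l /average (linear_scal _ HL); f_equal.
    rewrite scal_assoc /mult /= Rminus_0_r Rinv_l ?scal_one //; lra. }
  apply: Rle_trans (norm_scal _ _) _; rewrite /abs /=.
  have Hinv := Rinv_0_lt_compat _ Ht0.
  rewrite Rabs_pos_eq; last lra.
  have -> : 2 * t0 / t * norm x = / t0 * ((t0 - 0) * (2 * t0 / t * norm x)).
  { field; lra. }
  apply: Rmult_le_compat_l; first lra.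
  apply: (norm_RInt_le_const _ _ _ _ _ _ _ Hi); first lra.
  move=> s Hs; apply: Rle_trans (norm_average_shift _ _ _ _ _) _ => //; first lra.
  apply: Rmult_le_compat_r; first exact: norm_ge_0.
  apply: Rmult_le_compat_r; last lra.
  by apply: Rlt_le; exact: Rinv_0_lt_compat.
Qed.

(** * Consequences of one average contracting the kernel of [f] *)

Section Contraction.

Context (t0 d : R) (Ht0 : 0 < t0) (Hd : 0 <= d < 1).
Context (Hc : forall z, f z = 0 -> norm (average T t0 z) <= d * norm z).

Lemma norm_average_kernel t z : 0 < t -> f z = 0 ->
  norm (average T t z) <= 2 * t0 / t / (1 - d) * norm z.
Proof.
  move=> Ht.
  have HM := average_Markov t Ht; have HM0 := average_Markov t0 Ht0.
  (* [c] is the fixed point of the improvement map sending [m] to [2 * t0 / t + d * m]. *)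
  set c := 2 * t0 / t / (1 - d).
  have c0 : 0 <= c by apply: Rlt_le; repeat apply: Rdiv_lt_0_compat; lra.
  have Ec : 2 * t0 / t = c * (1 - d) by rewrite /c; field; lra.
  (* Each improvement multiplies the excess over [c] by [d]; the start [n = 0] follows from the
     Markov contraction bound 1. *)
  have H : forall n z, f z = 0 -> norm (average T t z) <= (c + d ^ n) * norm z.
  { elim=> [|n IH] {}z Hz.
    - have := Markov_norm HX _ z HM; have := norm_ge_0 z; simpl; nra.
    - have H1 := norm_average_average t t0 z Ht Ht0.
      have H2 : f (average T t0 z) = 0 by rewrite (Markov_functional HX).
      have H3 := IH _ H2; have H4 := Hc z Hz.
      have H5 : norm (average T t z) <=
          norm (average T t (average T t0 z)) +
          norm (minus (average T t (average T t0 z)) (average T t z)).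
      { rewrite -(norm_opp (minus _ _)) opp_minus.
        have {1}-> : average T t z = plus (average T t (average T t0 z))
            (minus (average T t z) (average T t (average T t0 z))).
        { by rewrite plus_comm /minus -plus_assoc plus_opp_l plus_zero_r. }
        exact: norm_triangle. }
      rewrite Ec in H1.
      have H6 : 0 <= c + d ^ n by have := pow_le d n (proj1 Hd); lra.
      have := Rmult_le_compat_l _ _ _ H6 H4; simpl; lra. }
  move=> Hz.
  have Hlim : is_lim_seq (fun n => (c + d ^ n) * norm z) ((c + 0) * norm z).
  { apply: (is_lim_seq_scal_r _ (norm z) (c + 0)).
    apply: is_lim_seq_plus'; first exact: is_lim_seq_const.
    apply: is_lim_seq_geom; rewrite Rabs_pos_eq; lra. }
  have := is_lim_seq_le _ _ _ _ (fun n => H n z Hz) (is_lim_seq_const _) Hlim.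
  by rewrite /= Rplus_0_r.
Qed.

(** The average at [t] sends the fixed point [x0] of the average at [t0] to another one. Their
    difference lies in the kernel and is not enlarged by a strict contraction, so it vanishes. *)
Lemma average_contraction_fixed_point :
  exists x0, base P f x0 /\ forall t, 0 < t -> average T t x0 = x0.
Proof.
  have HM0 := average_Markov t0 Ht0.
  case: (Markov_contraction_fixed_point HX _ _ HM0 Hd Hc) => x0 [Hb Hx0].
  exists x0; split=> // t Ht.
  have HM := average_Markov t Ht.
  (* Commutation is obtained twice: the average at [t] commutes with every [T s], hence with the
     average at [t0]. *)
  have Ecomm : average T t0 (average T t x0) = average T t x0.
  { rewrite average_commutes ?Hx0 //; first exact: (Markov_is_linear HX).
    move=> s y Hs; have HMs := semigroup_Markov s Hs.
    apply: average_commutes => //; first exact: (Markov_is_linear HX).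
    move=> r w Hr; rewrite -!semigroup_add //; f_equal; ring. }
  have Hz : f (minus (average T t x0) x0) = 0.
  { rewrite (functional_minus HX) (Markov_functional HX) //; ring. }
  have := Hc _ Hz; rewrite linear_map_minus; last exact: average_linear.
  rewrite Ecomm Hx0 => Hle.
  have H0 : minus (average T t x0) x0 = zero.
  { apply: norm_eq_zero; move: Hle (norm_ge_0 (minus (average T t x0) x0)).
    set r := norm _; have [_ Hd1] := Hd; nra. }
  by apply: (plus_reg_r (opp x0)); rewrite plus_opp_r.
Qed.

End Contraction.

End MarkovSemigroup.

(** * Suprema in [Rbar] and the Dobrushin coefficient *)

(** Membership of 0 rules out the supremum [m_infty], whose absolute value is [p_infty], and makes
    the absolute value harmless otherwise. *)
Lemma Lub_Rbar_abs_lt (E : R -> Prop) (m eps : R) :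
  E 0 -> (forall r, E r -> r <= m) -> m < eps -> Rbar_lt (Rbar_abs (Lub_Rbar E)) eps.
Proof.
  move=> E0 Em Hm; have [Hub Hleast] := Lub_Rbar_correct E.
  have H1 := Hub 0 E0.
  have H2 : Rbar_le (Lub_Rbar E) m by apply: Hleast => r; exact: Em.
  move: H1 H2; case: (Lub_Rbar E) => [r| |] //= H1 H2.
  rewrite Rabs_pos_eq; lra.
Qed.

Lemma lt_of_Lub_Rbar_abs (E : R -> Prop) (r eps : R) :
  Rbar_lt (Rbar_abs (Lub_Rbar E)) eps -> E r -> r < eps.
Proof.
  move=> H Er; have [/(_ r Er) Hub _] := Lub_Rbar_correct E.
  move: H Hub; case: (Lub_Rbar E) => [l| |] //= H Hub.
  have := Rle_abs l; lra.
Qed.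

Lemma dobrushin_lt_contraction {X : CompleteNormedModule R_AbsRing} (f : X -> R)
    (A : X -> X) (c : R) :
  0 < c -> linear_map A -> Rbar_lt (dobrushin f A) c ->
  exists d, 0 <= d < c /\ forall z, f z = 0 -> norm (A z) <= d * norm z.
Proof.
  move=> Hc HA; rewrite /dobrushin; set E := fun r : R => _.
  have [Hub _] := Lub_Rbar_correct E => Hlt.
  have [d [Hd HE]] : exists d, 0 <= d < c /\ forall r, E r -> r <= d.
  { move: Hub Hlt; case: (Lub_Rbar E) => [l| |] //= Hub Hlt.
    - exists (Rmax 0 l); split.
      + split; [exact: Rmax_l | exact: Rmax_lub_lt].
      + move=> r /Hub /= H; apply: Rle_trans H _; exact: Rmax_r.
    (* Here the supremum is [m_infty], so [E] is empty and the kernel of [f] is trivial. *)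
    - exists 0; split; first lra.
      by move=> r /Hub. }
  exists d; split=> // z Hz; case: (classic (z = zero)) => [->|Hn].
  - rewrite -(scal_zero_l zero) (proj2 HA) !scal_zero_l norm_zero; lra.
  - have H : norm (A z) / norm z <= d by apply: HE; exists z.
    have H0 : 0 < norm z by exact: norm_gt_0.
    have -> : norm (A z) = norm (A z) / norm z * norm z by field; lra.
    apply: Rmult_le_compat_r => //; lra.
Qed.

Lemma dobrushin_lt_of_norm_le {X : CompleteNormedModule R_AbsRing} (f : X -> R)
    (A : X -> X) (d c : R) :
  d < c -> (forall z, f z = 0 -> norm (A z) <= d * norm z) -> Rbar_lt (dobrushin f A) c.
Proof.
  move=> Hdc H; apply: (Rbar_le_lt_trans _ (Finite d)) => //.
  apply: (proj2 (Lub_Rbar_correct _)) => r [z [Hz [Hn ->]]] /=.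
  have H0 : 0 < norm z by exact: norm_gt_0.
  apply: (Rmult_le_reg_r (norm z)) => //.
  have -> : norm (A z) / norm z * norm z = norm (A z) by field; lra.
  exact: H.
Qed.

(** * The implications between the three ergodicity conditions *)

Section Equivalence.

Context {X : CompleteNormedModule R_AbsRing} {P : X -> Prop} {f : X -> R}.
Context {T : R -> X -> X}.
Context (HX : abstract_state_space P f) (HT : C0_Markov_semigroup P f T).

Lemma weakly_mean_ergodic_dobrushin : weakly_mean_ergodic P f T ->
  exists t0 : R, 0 < t0 /\ Rbar_lt (dobrushin f (average T t0)) 1.
Proof.
  move=> /(_ 1 Rlt_0_1) [M HM].
  pose t0 := Rmax M 0 + 1.
  have Ht0 : 0 < t0 by have := Rmax_r M 0; rewrite /t0; lra.
  have HMt : M < t0 by have := Rmax_l M 0; rewrite /t0; lra.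
  exists t0; split=> //.
  (* The image of the base has diameter at most 1 at time [t0], which gives the coefficient 1/2 on
     the kernel. *)
  apply: (dobrushin_lt_of_norm_le _ _ (1 / 2)); first lra.
  move=> z; apply: (norm_kernel_le HX); first exact: (average_linear HX HT).
  move=> u v Hu Hv; apply: Rlt_le; apply: (lt_of_Lub_Rbar_abs _ _ _ (HM t0 HMt)).
  by exists u, v.
Qed.

Lemma dobrushin_uniformly_mean_ergodic t0 :
  0 < t0 -> Rbar_lt (dobrushin f (average T t0)) 1 -> uniformly_mean_ergodic P f T.
Proof.
  move=> Ht0 Hdob.
  have HA := average_linear HX HT t0 Ht0.
  case: (dobrushin_lt_contraction _ _ _ Rlt_0_1 HA Hdob) => d [Hd Hc].
  case: (average_contraction_fixed_point HX HT t0 d Ht0 Hd Hc) => x0 [Hb Hfix].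
  have Hx0 := norm_base HX _ Hb.
  exists x0; split=> // eps Heps.
  (* The kernel bound [2 * t0 / t / (1 - d)] is applied to a vector of norm at most 2, and the
     product is below [eps] exactly when [t > M]. *)
  pose M := 4 * t0 / (1 - d) / eps.
  have HM : 0 < M by repeat apply: Rdiv_lt_0_compat; lra.
  exists M => t HMt.
  have Ht : 0 < t by lra.
  have HL := average_linear HX HT t Ht.
  apply: (Lub_Rbar_abs_lt _ (4 * t0 / (1 - d) / t)).
  - exists zero; rewrite norm_zero; split; first lra.
    rewrite /rank_one -(scal_zero_l zero) (proj2 HL) (functional_scal HX) Rmult_0_l.
    by rewrite !scal_zero_l minus_eq_zero norm_zero.
  - move=> r [x [Hx ->]].
    (* As [x0] is fixed by the average, subtracting the rank-one operator amounts to first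
       projecting [x] onto the kernel of [f] along [x0]. *)
    have -> : minus (average T t x) (rank_one f x0 x) =
              average T t (minus x (scal (f x) x0)).
    { by rewrite linear_map_minus // (proj2 HL) Hfix. }
    have Hz : f (minus x (scal (f x) x0)) = 0.
    { rewrite (functional_minus HX) (functional_scal HX) (proj2 Hb); ring. }
    have H1 := norm_average_kernel HX HT t0 d Ht0 Hd Hc t _ Ht Hz.
    apply: Rle_trans H1 _.
    have -> : 4 * t0 / (1 - d) / t = 2 * t0 / t / (1 - d) * 2 by field; lra.
    apply: Rmult_le_compat_l.
    { by apply: Rlt_le; repeat apply: Rdiv_lt_0_compat; lra. }
    apply: Rle_trans (norm_triangle _ _) _; rewrite norm_opp.
    have H2 := norm_scal (f x) x0; have H3 := functional_norm HX x.
    rewrite /abs /= in H2.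
    have H4 := Rmult_le_compat _ _ _ _ (Rabs_pos (f x)) (norm_ge_0 x0) (Rle_trans _ _ _ H3 Hx) Hx0.
    rewrite Rmult_1_l in H4; apply: (Rplus_le_compat _ 1 _ 1 Hx); exact: Rle_trans H2 H4.
  - apply: (Rmult_lt_reg_r t) => //.
    have -> : 4 * t0 / (1 - d) / t * t = M * eps by rewrite /M; field; lra.
    rewrite (Rmult_comm eps); exact: Rmult_lt_compat_r.
Qed.

Lemma uniformly_weakly_mean_ergodic :
  uniformly_mean_ergodic P f T -> weakly_mean_ergodic P f T.
Proof.
  move=> [x0 [Hb H]] eps Heps.
  (* Two distances to [x0] add up to [eps / 2], leaving the supremum strictly below [eps]. *)
  have He : 0 < eps / 4 by lra.
  case: (H _ He) => M HM; exists M => t HMt.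
  have Hnear u : base P f u -> norm (minus (average T t u) x0) <= eps / 4.
  { move=> Hu; apply: Rlt_le; apply: (lt_of_Lub_Rbar_abs _ _ _ (HM t HMt)).
    exists u; split; first exact: (norm_base HX).
    by rewrite /rank_one (proj2 Hu) scal_one. }
  apply: (Lub_Rbar_abs_lt _ (eps / 2)); last lra.
  - case: (base_nonempty HX) => u Hu; exists u, u.
    by rewrite minus_eq_zero norm_zero.
  - move=> r [x [y [Hx [Hy ->]]]].
    rewrite (minus_trans x0); apply: Rle_trans (norm_triangle _ _) _.
    have -> : eps / 2 = eps / 4 + eps / 4 by field.
    apply: Rplus_le_compat; first exact: Hnear.
    by rewrite -norm_opp opp_minus; exact: Hnear.
Qed.

End Equivalence.

Theorem theorem4p2
    (X : CompleteNormedModule R_AbsRing) (P : X -> Prop) (f : X -> R)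
    (HX : strong_abstract_state_space P f)
    (T : R -> X -> X) (HT : C0_Markov_semigroup P f T) :
  (weakly_mean_ergodic P f T <->
     exists t0 : R, 0 < t0 /\ Rbar_lt (dobrushin f (average T t0)) 1) /\
  ((exists t0 : R, 0 < t0 /\ Rbar_lt (dobrushin f (average T t0)) 1) <->
     uniformly_mean_ergodic P f T).
Proof.
  case: HX => HS _.
  have H12 := weakly_mean_ergodic_dobrushin HS HT.
  have H31 := uniformly_weakly_mean_ergodic HS (T := T).
  have H23 : (exists t0 : R, 0 < t0 /\ Rbar_lt (dobrushin f (average T t0)) 1) ->
      uniformly_mean_ergodic P f T.
  { move=> [t0 [Ht0 Hd]]; exact: (dobrushin_uniformly_mean_ergodic HS HT t0). }
  by split; split; auto.
Qed.
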